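(* Let $\Gamma$ be the fundamental group of a closed surface of genus $\geq e^{1000000}$, and let $|\cdot|$ be the diameter function on nonzero elements of $\mathbb Q\Gamma$ described in the context. Let $x$ and $y\neq 0$ be elements of $\mathbb Q\Gamma$ satisfying a nontrivial relation $ax+by=0$ (with $a,b\in\mathbb Q\Gamma$ not both zero). Put $r_{-1}=x$, $r_0=y$, and, as long as $r_i\neq 0$, divide $r_{i-1}$ by $r_i$, that is, choose $q_{i+1},r_{i+1}\in\mathbb Q\Gamma$ with $$r_{i-1}=q_{i+1}r_i+r_{i+1},\qquad |r_{i+1}|<|r_i| \text{ or } r_{i+1}=0.$$ Then such a division is possible at every stage, and after finitely many steps the process produces a nonzero element $z:=r_k$ that divides the previous element $r_{k-1}$ with no remainder (i.e. $r_{k+1}=0$). The element $z$ obtained in this way is a greatest common divisor of $x$ and $y$.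
   Context: Setting for $|\cdot|$: the surface is given a hyperbolic metric for which the deck transformation action of $\Gamma$ on $\mathbb H^2$ has infimum displacement $\inf\{d(p,\gamma p): p\in\mathbb H^2,\gamma\in\Gamma\setminus\{1\}\}\geq 2000$ (such a metric exists for genus $\geq e^{1000000}$ by a theorem of Buser). Fix a base point $p_0\in\mathbb H^2$ and identify $\gamma\in\Gamma$ with $\gamma p_0$. For $0\neq x=\sum x_\gamma\gamma\in\mathbb Q\Gamma$, $|x|$ is the maximal hyperbolic distance between two points of the support $\{\gamma p_0: x_\gamma\neq 0\}$. Divisors: $z$ is a divisor of $x$ (equivalently $z$ divides $x$) if $x=cz$ for some $c\in\mathbb Q\Gamma$. $z$ is a greatest common divisor of $x$ and $y$ if $z$ is a divisor of both $x$ and $y$ and every other common divisor $z'$ of $x$ and $y$ divides $z$. *)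

(* Defs.v *)
(* MathComp / MathComp-Analysis *)
From HB Require Import structures.
From mathcomp Require Import all_boot all_order all_algebra finmap.
From mathcomp Require Import monalg.
From mathcomp Require Import classical_sets reals topology normedtype sequences exp.

Set Implicit Arguments.
Unset Strict Implicit.
Unset Printing Implicit Defensive.

Import Order.TTheory GRing.Theory Num.Theory.
Import numFieldNormedType.Exports.

Local Open Scope ring_scope.

(* [monalg] provides a ring structure on {malg R[M]} only for monoids M in
   which x * y = 1 forces x = y = 1, so for a group G the convolution product
   is defined here, on top of the module {malg R[G]}. *)
Definition group_ring (R : nzRingType) (G : groupType) : Type := {malg R[G]}.

Section GroupRing.
Variables (R : nzRingType) (G : groupType).

HB.instance Definition _ := GRing.Lmodule.on (group_ring R G).

Implicit Types (x y z : {malg R[G]}).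

Definition gr_one : {malg R[G]} := mkmalgU 1%g 1.

Definition gr_mul x y : {malg R[G]} :=
  \sum_(g <- msupp x) \sum_(h <- msupp y) mkmalgU (g * h)%g (x@_g * y@_h).

Local Open Scope fset_scope.

Lemma gr_mulEw (d1 d2 : {fset G}) x y :
  msupp x `<=` d1 -> msupp y `<=` d2 ->
  gr_mul x y =
  \sum_(g <- d1) \sum_(h <- d2) mkmalgU (g * h)%g (x@_g * y@_h).
Proof.
move=> le1 le2; rewrite /gr_mul (big_fset_incl _ le1) /=.
  apply/eq_bigr=> g _; apply/big_fset_incl => // h _ /mcoeff_outdom ->.
  by rewrite mulr0 monalgU0.
move=> g _ /mcoeff_outdom xg.
by rewrite big1 // => h _; rewrite xg mul0r monalgU0.
Qed.

Lemma gr_mulDl : left_distributive gr_mul +%R.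
Proof.
move=> x y z.
rewrite (gr_mulEw (fsubsetUl (msupp x) (msupp y)) (fsubset_refl (msupp z))).
rewrite (gr_mulEw (fsubsetUr (msupp x) (msupp y)) (fsubset_refl (msupp z))).
rewrite (gr_mulEw (msuppD_le x y) (fsubset_refl (msupp z))).
rewrite -big_split /=; apply/eq_bigr=> g _.
rewrite -big_split /=; apply/eq_bigr=> h _.
by rewrite mcoeffD mulrDl monalgUD.
Qed.

Lemma gr_mulDr : right_distributive gr_mul +%R.
Proof.
move=> z x y.
rewrite (gr_mulEw (fsubset_refl (msupp z)) (fsubsetUl (msupp x) (msupp y))).
rewrite (gr_mulEw (fsubset_refl (msupp z)) (fsubsetUr (msupp x) (msupp y))).
rewrite (gr_mulEw (fsubset_refl (msupp z)) (msuppD_le x y)).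
rewrite -big_split /=; apply/eq_bigr=> g _.
rewrite -big_split /=; apply/eq_bigr=> h _.
by rewrite mcoeffD mulrDr monalgUD.
Qed.

Lemma gr_mul0l : left_zero 0 gr_mul.
Proof. by move=> x; rewrite /gr_mul msupp0 big_seq_fset0. Qed.

Lemma gr_mul0r : right_zero 0 gr_mul.
Proof.
by move=> x; rewrite /gr_mul big1 // => g _; rewrite msupp0 big_seq_fset0.
Qed.

Lemma gr_mulUU (g h : G) (a b : R) :
  gr_mul (mkmalgU g a) (mkmalgU h b) = mkmalgU (g * h)%g (a * b).
Proof. by rewrite (gr_mulEw msuppU_le msuppU_le) !big_seq_fset1 !mcoeffUU. Qed.

Lemma gr_mul_suml (I : Type) (s : seq I) (F : I -> {malg R[G]}) x :
  gr_mul (\sum_(i <- s) F i) x = \sum_(i <- s) gr_mul (F i) x.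
Proof.
exact: (big_morph (gr_mul^~ x) (fun _ _ => gr_mulDl _ _ _) (gr_mul0l _)).
Qed.

Lemma gr_mul_sumr (I : Type) (s : seq I) (F : I -> {malg R[G]}) x :
  gr_mul x (\sum_(i <- s) F i) = \sum_(i <- s) gr_mul x (F i).
Proof.
exact: (big_morph (gr_mul x) (fun _ _ => gr_mulDr _ _ _) (gr_mul0r _)).
Qed.

Lemma gr_mul1l : left_id gr_one gr_mul.
Proof.
move=> x; rewrite [in LHS](monalgE x) gr_mul_sumr [RHS]monalgE.
by apply/eq_bigr=> g _; rewrite gr_mulUU mul1r mul1g.
Qed.

Lemma gr_mul1r : right_id gr_one gr_mul.
Proof.
move=> x; rewrite [in LHS](monalgE x) gr_mul_suml [RHS]monalgE.
by apply/eq_bigr=> g _; rewrite gr_mulUU mulr1 mulg1.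
Qed.

Lemma gr_mulA : associative gr_mul.
Proof.
move=> x y z; rewrite (monalgE x) !gr_mul_suml; apply/eq_bigr=> g _.
rewrite (monalgE y) gr_mul_suml !gr_mul_sumr gr_mul_suml.
apply/eq_bigr=> h _.
rewrite (monalgE z) !gr_mul_sumr; apply/eq_bigr=> k _.
by rewrite !gr_mulUU mulrA mulgA.
Qed.

Lemma gr_one_neq0 : gr_one != 0.
Proof. by rewrite monalgU_eq0 oner_eq0. Qed.

HB.instance Definition _ := GRing.Zmodule_isNzRing.Build (group_ring R G)
  gr_mulA gr_mul1l gr_mul1r gr_mulDl gr_mulDr gr_one_neq0.

End GroupRing.

(* The upper half-plane {(u, v) | v > 0}. *)
Record hplane (R : realType) :=
  HPlane { hp_val : R * R ; hp_valP : 0 < hp_val.2 }.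

HB.instance Definition _ (R : realType) := [isSub for @hp_val R].
HB.instance Definition _ (R : realType) := [Choice of hplane R by <:].

Section Hyperbolic.
Variable R : realType.
Implicit Types p q : hplane R.

(* Meaningful for 1 <= t. *)
Definition arcosh (t : R) : R := ln (t + Num.sqrt (t ^+ 2 - 1)).

Definition hdist p q : R :=
  let: (u1, v1) := hp_val p in
  let: (u2, v2) := hp_val q in
  arcosh (1 + ((u1 - u2) ^+ 2 + (v1 - v2) ^+ 2) / (2 * v1 * v2)).

Variables (G : groupType) (act : G -> hplane R -> hplane R).

(* G acts by isometries as the deck group of the covering of the hyperbolic
   plane onto a closed hyperbolic surface: each point has a ball disjoint from
   all its nontrivial translates, and the quotient is compact.  Compactness is
   read in the ambient R * R, whose subspace topology on the half-plane is the
   one given by hdist. *)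
Record deck_action : Prop := DeckAction {
  deck_act1 : forall p, act 1%g p = p ;
  deck_actM : forall g h p, act (g * h)%g p = act g (act h p) ;
  deck_isometry : forall g p q, hdist (act g p) (act g q) = hdist p q ;
  deck_covering : forall p, exists2 e : R, 0 < e &
    forall (g : G) q, g != 1%g -> hdist p q < e -> ~~ (hdist p (act g q) < e) ;
  deck_cocompact : exists2 K : set (hplane R),
    compact (image K (@hp_val R)) & forall p, exists g, K (act g p)
}.

Definition inf_displacement : R :=
  inf [set t | exists p (g : G), g != 1%g /\ t = hdist p (act g p)]%classic.

(* For x != 0 this is the maximum over pairs of the support: the default value
   0 of the iterated maximum is the distance of any point to itself. *)
Definition diam (F : nzRingType) (p0 : hplane R) (x : group_ring F G) : R :=
  \big[Num.max/0]_(g <- msupp x) \big[Num.max/0]_(h <- msupp x)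
    hdist (act g p0) (act h p0).

End Hyperbolic.

(* G is the fundamental group of the closed orientable surface of genus n:
   < a_1, b_1, ..., a_n, b_n | [a_1, b_1] ... [a_n, b_n] = 1 >,
   the presentation being expressed by its universal property. *)
Definition surface_group (n : nat) (G : groupType) : Prop :=
  exists a b : 'I_n -> G,
    (\prod_(i < n) [~ a i, b i] = 1)%g /\
    forall (H : groupType) (a' b' : 'I_n -> H),
      (\prod_(i < n) [~ a' i, b' i] = 1)%g ->
      exists f : {multiplicative G -> H},
        (forall i, f (a i) = a' i /\ f (b i) = b' i) /\
        forall f' : {multiplicative G -> H},
          (forall i, f' (a i) = a' i /\ f' (b i) = b' i) -> f' =1 f.

Section Division.
Variable A : nzRingType.
Implicit Types x y z q r : A.

Definition divides z x : Prop := exists c, x = c * z.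

Definition is_gcd z x y : Prop :=
  [/\ divides z x, divides z y &
      forall z', divides z' x -> divides z' y -> divides z' z].

Variables (R : realType) (N : A -> R).

Definition division_step x y q r : Prop :=
  x = q * y + r /\ (N r < N y \/ r = 0).

(* The first n divisions of the process started at x, y.  Indices of the
   remainders are shifted by one, r 0 = x = r_{-1} and r 1 = y = r_0; the i-th
   division divides r i by r (i + 1), with quotient q i. *)
Definition euclid_run x y (r q : nat -> A) (n : nat) : Prop :=
  [/\ r 0%N = x, r 1%N = y &
      forall i, (i < n)%N ->
        r i.+1 != 0 /\ division_step (r i) (r i.+1) (q i) (r i.+2)].

End Division.

(* Main.v *)
(* All estimates hold up to bounded errors in the Gromov hyperbolic plane.
   Suppose a x + b y = 0 with |y| <= |x| and let w0 be the point of the support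
   of w = a x = - b y farthest from p0, at distance D.  The translates h x, for
   h in the support of a, have centers at least 2000 apart, so two of them
   cannot both contain points near each other at distance >= D - 100 from p0:
   there, no cancellation occurs in a x, nor (likewise) in b y.  Let al x be the translate
   of x through w0.  Its points at distance >= D - 100 are cancelled by the
   translates be y that reach them, so subtracting from x the corresponding
   combination of the al^-1 be y leaves x' such that al x' lies within D - 100
   of p0 and (essentially) in the smallest ball around al x; hyperbolicity then
   gives |x'| < |x|.  Iterating yields the division of x by y.  The remainders
   have strictly decreasing diameters, which are distances between points of an
   orbit whose points are 2000 apart, so the process stops. *)

Require Import Defs.
From HB Require Import structures.
From mathcomp Require Import all_boot all_order all_algebra finmap.
From mathcomp Require Import monalg ring lra.
From mathcomp Require Import boolp.
From mathcomp Require Import classical_sets reals topology normedtype sequences exp.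

Set Implicit Arguments.
Unset Strict Implicit.
Unset Printing Implicit Defensive.

Import Order.TTheory GRing.Theory Num.Theory.
Import numFieldNormedType.Exports.

Local Open Scope ring_scope.

(** * Coarse geometry of the upper half-plane: four-point inequality and midpoints *)

Section HyperbolicPlane.
Variable R : realType.
Implicit Types a b c d p q m : hplane R.

Definition cosh_hdist p q : R :=
  1 + (((hp_val p).1 - (hp_val q).1) ^+ 2 + ((hp_val p).2 - (hp_val q).2) ^+ 2) /
      (2 * (hp_val p).2 * (hp_val q).2).

Lemma hdistE p q : hdist p q = arcosh (cosh_hdist p q).
Proof. by rewrite /hdist /cosh_hdist; case: (hp_val p); case: (hp_val q). Qed.

Lemma cosh_hdist_ge1 p q : 1 <= cosh_hdist p q.
Proof.
rewrite /cosh_hdist lerDl divr_ge0 ?addr_ge0 ?sqr_ge0 // ltW //.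
by rewrite !mulr_gt0 ?hp_valP.
Qed.

Lemma arcosh_bounds (t : R) : 1 <= t -> t <= expR (arcosh t) <= 2 * t.
Proof.
move=> t1; have s0 := sqrtr_ge0 (t ^+ 2 - 1).
rewrite /arcosh lnK ?posrE; last by lra.
have : Num.sqrt (t ^+ 2 - 1) <= Num.sqrt (t ^+ 2) by rewrite ler_wsqrtr //; lra.
by rewrite sqrtr_sqr ger0_norm; lra.
Qed.

Lemma hdist_bounds p q :
  cosh_hdist p q <= expR (hdist p q) <= 2 * cosh_hdist p q.
Proof. by rewrite hdistE arcosh_bounds ?cosh_hdist_ge1. Qed.

Lemma hdist_ge0 p q : 0 <= hdist p q.
Proof.
rewrite -ler_expR expR0.
by have := hdist_bounds p q; have := cosh_hdist_ge1 p q; lra.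
Qed.

Lemma hdistC p q : hdist p q = hdist q p.
Proof.
rewrite !hdistE /cosh_hdist -(sqrrN (_.1 - _)) -(sqrrN (_.2 - _)) !opprB.
by rewrite (mulrAC 2).
Qed.

Lemma hdistpp p : hdist p p = 0.
Proof.
rewrite hdistE /cosh_hdist !subrr expr0n /= addr0 mul0r addr0 /arcosh expr1n.
by rewrite subrr sqrtr0 addr0 ln1.
Qed.

(* |z_p - conj z_q|^2 / (2 v_p v_q), that is, 2 (cosh (d / 2))^2. *)
Definition chord p q : R :=
  (((hp_val p).1 - (hp_val q).1) ^+ 2 + ((hp_val p).2 + (hp_val q).2) ^+ 2) /
      (2 * (hp_val p).2 * (hp_val q).2).

Lemma chordE p q : chord p q = cosh_hdist p q + 1.
Proof.
rewrite /chord /cosh_hdist; have := hp_valP p; have := hp_valP q.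
by move=> hq hp; field; rewrite !gt_eqF.
Qed.

Lemma chord_bounds p q : chord p q / 2 <= expR (hdist p q) <= 2 * chord p q.
Proof.
rewrite chordE; have := hdist_bounds p q; have := cosh_hdist_ge1 p q.
lra.
Qed.

(* Ptolemy's identity for the points a, conj b, c, conj d of the complex plane. *)
Lemma chord_ptolemy a b c d :
  chord a b * chord c d <= 2 * (chord a c * chord b d + chord a d * chord b c).
Proof.
rewrite /chord; have := hp_valP a; have := hp_valP b; have := hp_valP c; have := hp_valP d.
case: (hp_val a) (hp_val b) (hp_val c) (hp_val d)
  => [a1 a2] [b1 b2] [c1 c2] [d1 d2] /= d0 c0 b0 a0.
rewrite -subr_ge0.
set A := _ - _.
have -> : A = (2 * (((a1 - c1) ^+ 2 + (a2 + c2) ^+ 2) * ((b1 - d1) ^+ 2 + (b2 + d2) ^+ 2)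
   + ((a1 - d1) ^+ 2 + (a2 + d2) ^+ 2) * ((b1 - c1) ^+ 2 + (b2 + c2) ^+ 2))
   - ((a1 - b1) ^+ 2 + (a2 + b2) ^+ 2) * ((c1 - d1) ^+ 2 + (c2 + d2) ^+ 2))
   / (4 * a2 * b2 * c2 * d2).
  by rewrite /A; field; rewrite !gt_eqF.
rewrite divr_ge0 //; last by rewrite ltW // !mulr_gt0.
(* With P = (a - c)(conj b - conj d) and Q = (conj b - c)(a - conj d), the product (a - conj b)(c -
   conj d) is P - Q, and the parallelogram law leaves |P + Q|^2. The multiple of 8 comes from |a -
   conj c|^2 = |a - c|^2 + 4 a2 c2 and its analogue for b, d. *)
set X := (X in 0 <= X).
have -> : X = (((a1 - c1) * (b1 - d1) + (a2 - c2) * (b2 - d2))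
       + ((b1 - c1) * (a1 - d1) - (- b2 - c2) * (a2 + d2))) ^+ 2
  + ((a2 - c2) * (b1 - d1) - (a1 - c1) * (b2 - d2)
     + ((- b2 - c2) * (a1 - d1) + (b1 - c1) * (a2 + d2))) ^+ 2
  + 8 * (a2 * c2 * ((b1 - d1) ^+ 2 + (b2 + d2) ^+ 2)
         + b2 * d2 * ((a1 - c1) ^+ 2 + (a2 - c2) ^+ 2)).
  rewrite /X; ring.
rewrite addr_ge0 ?(addr_ge0, sqr_ge0) // mulr_ge0 // addr_ge0 // mulr_ge0 //.
- by rewrite ltW ?mulr_gt0.
- by rewrite addr_ge0 ?sqr_ge0.
- by rewrite ltW ?mulr_gt0.
by rewrite addr_ge0 ?sqr_ge0.
Qed.

Lemma chord_gt0 p q : 0 < chord p q.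
Proof. by rewrite chordE; have := cosh_hdist_ge1 p q; lra. Qed.

Lemma hdist_four_point a b c d :
  hdist a b + hdist c d <= hdist a c + hdist b d + 6 \/
  hdist a b + hdist c d <= hdist a d + hdist b c + 6.
Proof.
have e2 : 2 <= expR 1 :> R by have := expR_ge1Dx (1 : R); lra.
have e6 : 64 <= expR 6 :> R.
  have -> : 6 = 6%:R * 1 :> R by rewrite mulr1.
  rewrite expRM_natl (_ : 64 = 2 ^+ 6); last by ring.
  by rewrite lerXn2r ?nnegrE ?expR_ge0.
have half (p q p' q' : hplane R) :
    chord a b * chord c d <= 4 * (chord p q * chord p' q') ->
    hdist a b + hdist c d <= hdist p q + hdist p' q' + 6.
  move=> le4; rewrite -ler_expR (expRD _ 6) (expRD (hdist p q)) expRD.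
  have /andP[_ ab] := chord_bounds a b; have /andP[_ cd] := chord_bounds c d.
  have /andP[pq _] := chord_bounds p q; have /andP[pq' _] := chord_bounds p' q'.
  have le1 : expR (hdist a b) * expR (hdist c d) <=
      (2 * chord a b) * (2 * chord c d) by rewrite ler_pM ?expR_ge0.
  have le2 : (chord p q / 2) * (chord p' q' / 2) <=
      expR (hdist p q) * expR (hdist p' q').
    by rewrite ler_pM // divr_ge0 // ltW ?chord_gt0.
  have le3 : expR (hdist p q) * expR (hdist p' q') * 64 <=
      expR (hdist p q) * expR (hdist p' q') * expR 6.
    by rewrite ler_wpM2l // mulr_ge0 ?expR_ge0.
  apply: le_trans le1 _; apply: le_trans le3.
  have -> : 2 * chord a b * (2 * chord c d) = 4 * (chord a b * chord c d) by ring.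
  have l5 : chord p q * chord p' q' <= 4 * (expR (hdist p q) * expR (hdist p' q')).
    by move: le2; rewrite mulrACA; lra.
  by move: le4 l5; lra.
have := chord_ptolemy a b c d.
case: (leP (chord a d * chord b c) (chord a c * chord b d)) => le_cd ptol.
  by left; apply: half; move: ptol le_cd; lra.
by right; apply: half; move: ptol le_cd; lra.
Qed.

Lemma hdist_weak_triangle p q m : hdist p q <= hdist p m + hdist m q + 6.
Proof.
by have [] := hdist_four_point p q m m; rewrite hdistpp (hdistC q m); lra.
Qed.

(** Here [s] is 2 cosh (d / 2), where d is the distance of the two points, so the new point is their
    exact hyperbolic midpoint. *)
Lemma midpoint_cosh (p1 p2 q1 q2 s : R) : 0 < p2 -> 0 < q2 -> 0 < s ->
  s ^+ 2 * (p2 * q2) = (p1 - q1) ^+ 2 + (p2 + q2) ^+ 2 ->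
  1 + ((p1 - (p1 * q2 + q1 * p2) / (p2 + q2)) ^+ 2
       + (p2 - s * p2 * q2 / (p2 + q2)) ^+ 2)
      / (2 * p2 * (s * p2 * q2 / (p2 + q2))) = s / 2.
Proof.
move=> p0 q0 s0 sE.
have D0 : p2 + q2 != 0 by rewrite gt_eqF ?addr_gt0.
have -> : p1 - (p1 * q2 + q1 * p2) / (p2 + q2) = (p1 - q1) * (p2 / (p2 + q2)).
  by field.
rewrite exprMn (_ : (p1 - q1) ^+ 2 = s ^+ 2 * (p2 * q2) - (p2 + q2) ^+ 2).
  by field; rewrite D0 !gt_eqF.
by rewrite sE addrK.
Qed.

Lemma hdist_midpoint p q :
  exists m, hdist p m <= hdist p q / 2 + 1 /\ hdist q m <= hdist p q / 2 + 1.
Proof.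
have c0 := chord_gt0 p q.
pose s := Num.sqrt (2 * chord p q).
have s0 : 0 < s by rewrite sqrtr_gt0; lra.
have sE : s ^+ 2 = 2 * chord p q by rewrite sqr_sqrtr //; lra.
have p0 := hp_valP p; have q0 := hp_valP q.
pose m1 := ((hp_val p).1 * (hp_val q).2 + (hp_val q).1 * (hp_val p).2)
           / ((hp_val p).2 + (hp_val q).2).
pose m2 := s * (hp_val p).2 * (hp_val q).2 / ((hp_val p).2 + (hp_val q).2).
have m0 : 0 < (m1, m2).2 by rewrite /= divr_gt0 ?addr_gt0 ?mulr_gt0.
exists (HPlane m0).
have e2 : 2 <= expR 1 :> R by have := expR_ge1Dx (1 : R); lra.
have bound x : cosh_hdist x (HPlane m0) = s / 2 ->
    hdist x (HPlane m0) <= hdist p q / 2 + 1.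
  move=> xE; have /andP[_] := hdist_bounds x (HPlane m0).
  have -> : 2 * cosh_hdist x (HPlane m0) = s by rewrite xE; lra.
  (* The square of [les] is bounded by s^2 = 2 [chord p q], hence by 4 [expR (hdist p q)]; the error
     comes from 4 <= e^2. *)
  move=> les; suff : 2 * hdist x (HPlane m0) <= hdist p q + 2 by lra.
  rewrite -ler_expR (expRD _ 2) (expRM_natl 2).
  have : expR (hdist x (HPlane m0)) ^+ 2 <= s ^+ 2.
    by rewrite lerXn2r ?nnegrE ?expR_ge0 // ltW.
  rewrite sE => les2.
  have := chord_bounds p q.
  have e4 : 4 <= expR 2 :> R.
    have -> : 2 = 2%:R * 1 :> R by rewrite mulr1.
    rewrite expRM_natl (_ : 4 = 2 ^+ 2); last by ring.
    by rewrite lerXn2r ?nnegrE ?expR_ge0.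
  have : expR (hdist p q) * 4 <= expR (hdist p q) * expR 2.
    by rewrite ler_wpM2l ?expR_ge0.
  lra.
have sqE : s ^+ 2 * ((hp_val p).2 * (hp_val q).2) =
    ((hp_val p).1 - (hp_val q).1) ^+ 2 + ((hp_val p).2 + (hp_val q).2) ^+ 2.
  by rewrite sE /chord; field; rewrite !gt_eqF.
split; apply: bound; rewrite /cosh_hdist /= /m1 /m2.
  exact: midpoint_cosh.
rewrite (addrC (_.1 * _)) (addrC (hp_val p).2) (mulrAC s); apply: midpoint_cosh => //.
by rewrite (mulrC (hp_val q).2) sqE -(sqrrN (_.1 - _)) opprB (addrC (hp_val q).2).
Qed.
End HyperbolicPlane.

(** * Finite maxima and coefficients of products *)

Lemma exists_argmax (R : realDomainType) (T : eqType) (f : T -> R) (s : seq T) t0 :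
  t0 \in s -> exists2 t, t \in s & forall u, u \in s -> f u <= f t.
Proof.
elim: s t0 => // t s IH t0 _; case: s IH => [_|t1 s IH].
  by exists t => [|u]; rewrite ?mem_head // inE => /eqP->.
have [m ms max_m] := IH t1 (mem_head _ _).
have [le_tm|lt_mt] := leP (f t) (f m).
  exists m => [|u]; first by rewrite inE ms orbT.
  by rewrite inE => /predU1P[->|/max_m].
exists t => [|u]; first exact: mem_head.
by rewrite inE => /predU1P[-> //|/max_m/le_trans]; apply; apply: ltW.
Qed.

Section GroupRingCoefficients.
Variables (F : nzRingType) (G : groupType).
Implicit Types x y : {malg F[G]}.

Lemma msupp_neq0 x : x != 0 -> exists g, g \in msupp x.
Proof.
move=> x0; apply/fset0Pn; apply: contraNneq x0 => s0; apply/eqP/malgP => g.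
by rewrite mcoeff0 mcoeff_outdom // s0.
Qed.

Lemma mcoeff_gr_mulU h k y g :
  (gr_mul (mkmalgU h k) y)@_g = k * y@_(h^-1 * g)%g.
Proof.
rewrite (gr_mulEw msuppU_le (fsubset_refl _)) big_seq_fset1 mcoeffUU.
rewrite raddf_sum /=.
under eq_bigr => j _ do rewrite mcoeffU.
case: (boolP ((h^-1 * g)%g \in msupp y)) => [gy|gy].
  rewrite (big_fsetD1 _ gy) /= mulVKg eqxx mulr1n big1_fset ?addr0 // => j.
  rewrite !inE => /andP[jg _] _; case: eqP => // hj.
  by rewrite -hj mulKg eqxx in jg.
rewrite (mcoeff_outdom gy) mulr0 big1_fset // => j jy _; case: eqP => // hj.
by rewrite -hj mulKg jy in gy.
Qed.

Lemma mcoeff_gr_mul x y g :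
  (gr_mul x y)@_g = \sum_(h <- msupp x) x@_h * y@_(h^-1 * g)%g.
Proof.
rewrite [in LHS](monalgE x) gr_mul_suml raddf_sum /=.
by apply: eq_bigr => h _; rewrite mcoeff_gr_mulU.
Qed.

Lemma msupp_gr_mul x y g : g \in msupp (gr_mul x y) ->
  exists h k, [/\ h \in msupp x, k \in msupp y & g = (h * k)%g].
Proof.
rewrite -mcoeff_neq0 mcoeff_gr_mul => nz.
have [/hasP[h hx]|none] := boolP (has (fun h => (h^-1 * g)%g \in msupp y) (msupp x)).
  by move=> hy; exists h, (h^-1 * g)%g; rewrite mulVKg.
rewrite big1_seq ?eqxx // in nz => h /andP[_ hx].
by move/hasPn: none => /(_ h hx) /mcoeff_outdom ->; rewrite mulr0.
Qed.

End GroupRingCoefficients.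

(** * Diameters and centers of supports *)

Section Diameter.
Variables (R : realType) (G : groupType) (act : G -> hplane R -> hplane R).
Variables (F : nzRingType) (p0 : hplane R).
Implicit Types x : group_ring F G.
Local Notation N := (@diam R G act F p0).
Local Notation pt g := (act g p0).

Lemma hdist_le_diam x g h : g \in msupp x -> h \in msupp x ->
  hdist (pt g) (pt h) <= N x.
Proof.
move=> gx hx; rewrite /diam.
apply: (bigmax_sup_seq 0 g) => //; exact: (le_bigmax_seq 0 h).
Qed.

Lemma diam_ge0 x : 0 <= N x.
Proof. exact: bigmax_ge_id. Qed.

Lemma diam_le x (B : R) : 0 <= B ->
  (forall g h, g \in msupp x -> h \in msupp x -> hdist (pt g) (pt h) <= B) ->
  N x <= B.
Proof.
move=> B0 le_B; rewrite /diam big_seq; apply: bigmax_le => // g gx.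
by rewrite big_seq; apply: bigmax_le => // h hx; apply: le_B.
Qed.

Lemma diam_attained x : x != 0 ->
  exists g h, [/\ g \in msupp x, h \in msupp x & N x = hdist (pt g) (pt h)].
Proof.
move=> /msupp_neq0[g0 g0x].
pose s := [seq (g, h) | g <- msupp x, h <- msupp x].
have s0 : (g0, g0) \in s by apply/allpairsP; exists (g0, g0).
have [[g h] /allpairsP[[g' h'] [/= gx hx [-> ->]]] max_gh] :=
  exists_argmax (fun u : G * G => hdist (pt u.1) (pt u.2)) s0.
exists g', h'; split => //; apply/le_anti; rewrite hdist_le_diam // andbT.
apply: diam_le => [|g1 h1 g1x h1x]; first exact: hdist_ge0.
by apply: (max_gh (g1, h1)); apply/allpairsP; exists (g1, h1).
Qed.

(** The midpoint of a diametral pair works. The four-point inequality with this pair bounds the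
    distance from [c] to the other support points, and shows that from any [p] one end of the pair
    is far enough. The error is 6 + 1. *)
Lemma center_exists x : x != 0 -> exists c : hplane R,
  (forall g, g \in msupp x -> hdist c (pt g) <= N x / 2 + 7) /\
  (forall p, exists2 g, g \in msupp x & hdist p c + N x / 2 - 7 <= hdist p (pt g)).
Proof.
move=> /diam_attained[g [h [gx hx NE]]].
have [c] := hdist_midpoint (pt g) (pt h); rewrite -NE => -[cg ch].
exists c; split => [k kx|p].
  have := hdist_le_diam gx kx; have := hdist_le_diam hx kx.
  have := hdist_four_point c (pt k) (pt g) (pt h).
  rewrite -NE (hdistC c (pt g)) (hdistC c (pt h)) (hdistC (pt k) (pt g)).
  by rewrite (hdistC (pt k) (pt h)); case; lra.
have := hdist_four_point p c (pt g) (pt h).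
by rewrite -NE (hdistC c (pt g)) (hdistC c (pt h)); case=> le_; [exists g|exists h] => //; lra.
Qed.

End Diameter.

(** * Absence of cancellation far from a point *)

Section Clusters.
Variables (R : realType) (G : groupType) (act : G -> hplane R -> hplane R).
Variables (F : fieldType) (p0 : hplane R).
Hypothesis deck : deck_action act.
Hypothesis displacement :
  forall (g : G) p, g != 1%g -> 2000%:R <= hdist p (act g p).
Implicit Types (a b x y : group_ring F G) (p c : hplane R) (D : R).
Local Notation N := (@diam R G act F p0).
Local Notation pt g := (act g p0).

Definition center x c : Prop :=
  (forall g, g \in msupp x -> hdist c (pt g) <= N x / 2 + 7) /\
  (forall p, exists2 g, g \in msupp x & hdist p c + N x / 2 - 7 <= hdist p (pt g)).

(** All products count here, including those that cancel in [a * x]. *)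
Definition bounded_product p a x D : Prop :=
  forall h k, h \in msupp a -> k \in msupp x -> hdist p (pt (h * k)%g) <= D.

Lemma hdist_translate h k c : hdist (act h c) (pt (h * k)%g) = hdist c (pt k).
Proof. by rewrite (deck_actM deck) (deck_isometry deck). Qed.

Lemma hdist_act_eq h k c : hdist (act h c) (act k c) < 2000 -> h = k.
Proof.
move=> lt_; apply/eqP; apply: contraTT lt_ => neq_hk; rewrite -leNgt.
have := displacement (g := (k * h^-1)%g) (act h c).
rewrite -(deck_actM deck) mulgVK => -> //.
by rewrite divg_eq1 eq_sym.
Qed.

Lemma center_bound p a x D c h : center x c -> bounded_product p a x D ->
  h \in msupp a -> hdist p (act h c) + N x / 2 <= D + 7.
Proof.
move=> [_ far] bd ha; have [k kx] := far (act h^-1%g p).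
have E q : hdist (act h^-1%g p) q = hdist p (act h q).
  by rewrite -[LHS](deck_isometry deck h) -(deck_actM deck) mulgV (deck_act1 deck).
rewrite !E -(deck_actM deck); have := bd _ _ ha kx; lra.
Qed.

(** By [center_bound] both translated centers lie within about [D - N x / 2] of [p], while both deep
    points lie near distance [D]. So both centers are near the geodesic from [p] to the second deep
    point, at about the same depth. The four-point inequality puts them at most 326 apart, and 2000
    separates distinct translates. *)
Lemma same_translate p a x D h k h' k' :
  x != 0 -> bounded_product p a x D ->
  h \in msupp a -> k \in msupp x -> h' \in msupp a -> k' \in msupp x ->
  D - 100 <= hdist p (pt (h * k)%g) -> D - 100 <= hdist p (pt (h' * k')%g) ->
  hdist (pt (h * k)%g) (pt (h' * k')%g) <= N x + 100 -> h = h'.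
Proof.
move=> x0 bd ha kx ha' kx' deep deep' near.
have [c cx] := center_exists act p0 x0.
have := center_bound cx bd ha; have := center_bound cx bd ha'.
have := cx.1 _ kx; have := cx.1 _ kx'.
rewrite -(hdist_translate h k) -(hdist_translate h' k') => near_h' near_h bh' bh.
have le_bd := bd _ _ ha kx; have le_bd' := bd _ _ ha' kx'.
have h_to_k' : hdist (act h c) (pt (h' * k')%g) <= N x / 2 + 213.
  have := hdist_four_point (act h c) (pt (h' * k')%g) p (pt (h * k)%g).
  rewrite (hdistC (act h c) p) (hdistC (pt (h' * k')%g) p).
  by rewrite (hdistC (pt (h' * k')%g)); case; lra.
apply: (@hdist_act_eq _ _ c).
have := hdist_four_point (act h c) (act h' c) p (pt (h' * k')%g).
by rewrite (hdistC (act h c) p) (hdistC (act h' c) p); case; lra.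
Qed.

(** Two factorizations of one deep element give points at distance 0, so [same_translate] leaves a
    single term in the convolution sum. *)
Lemma mcoeff_outer p a x D h k :
  x != 0 -> bounded_product p a x D ->
  h \in msupp a -> k \in msupp x -> D - 100 <= hdist p (pt (h * k)%g) ->
  (a * x : group_ring F G)@_(h * k)%g = a@_h * x@_k.
Proof.
move=> x0 bd ha kx deep; rewrite mcoeff_gr_mul (big_fsetD1 _ ha) /= mulKg.
rewrite big1_fset ?addr0 // => h'; rewrite !inE => /andP[h'h ha'] _.
case: (boolP ((h'^-1 * (h * k))%g \in msupp x)) => [kx'|/mcoeff_outdom->]; last first.
  by rewrite mulr0.
have E : (h * k = h' * (h'^-1 * (h * k)))%g by rewrite mulVKg.
case/eqP: h'h; apply: (same_translate x0 bd ha' kx' ha kx).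
- by rewrite -E.
- by [].
- by rewrite -E hdistpp; have := diam_ge0 act p0 x; lra.
Qed.

Lemma msupp_outer p a x D h k :
  x != 0 -> bounded_product p a x D ->
  h \in msupp a -> k \in msupp x -> D - 100 <= hdist p (pt (h * k)%g) ->
  (h * k)%g \in msupp (a * x : group_ring F G).
Proof.
move=> x0 bd ha kx deep; rewrite -mcoeff_neq0 (mcoeff_outer x0 bd) //.
by rewrite mulf_neq0 // mcoeff_neq0.
Qed.

Lemma farthest_product p a x : a != 0 -> x != 0 ->
  exists h k, [/\ h \in msupp a, k \in msupp x &
                  bounded_product p a x (hdist p (pt (h * k)%g))].
Proof.
move=> /msupp_neq0[h0 h0a] /msupp_neq0[k0 k0x].
pose s := [seq (h, k) | h <- msupp a, k <- msupp x].
have s0 : (h0, k0) \in s by apply/allpairsP; exists (h0, k0).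
have [[h k] /allpairsP[[h' k'] [/= ha kx [-> ->]]] max_] :=
  exists_argmax (fun u : G * G => hdist p (pt (u.1 * u.2)%g)) s0.
exists h', k'; split=> // h1 k1 ha1 kx1.
by apply: (max_ (h1, k1)); apply/allpairsP; exists (h1, k1).
Qed.

Lemma gr_mul_neq0 a x : a != 0 -> x != 0 -> a * x != 0.
Proof.
move=> a0 x0; have [h [k [ha kx bd]]] := farthest_product p0 a0 x0.
apply/eqP => ax0.
have : (h * k)%g \in msupp (a * x : group_ring F G).
  by apply: (msupp_outer x0 bd) => //; lra.
by rewrite ax0 -mcoeff_neq0 mcoeff0 eqxx.
Qed.

End Clusters.

(** * One reduction step of the division *)

Section Division.
Variables (R : realType) (G : groupType) (act : G -> hplane R -> hplane R).
Variables (F : fieldType) (p0 : hplane R).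
Hypothesis deck : deck_action act.
Hypothesis displacement :
  forall (g : G) p, g != 1%g -> 2000%:R <= hdist p (act g p).
Implicit Types (a b x y : group_ring F G) (p c : hplane R).
Local Notation N := (@diam R G act F p0).
Local Notation pt g := (act g p0).

(** The drop by a fixed amount, rather than a strict inequality alone, lets the step be iterated by
    induction in [division_exists]. *)
Lemma diam_reduction a b x y : a != 0 -> x != 0 -> y != 0 ->
  a * x + b * y = 0 -> N y <= N x ->
  exists q, x - q * y = 0 \/ N (x - q * y) <= N x - 1.
Proof.
move=> a0 x0 y0 rel le_yx.
have axE : a * x = - (b * y) by apply/eqP; rewrite -addr_eq0 rel.
have axEc g : (a * x : group_ring F G)@_g = - (b * y : group_ring F G)@_g.
  by rewrite axE mcoeffN.
have supp_eq g : (g \in msupp (a * x : group_ring F G)) =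
    (g \in msupp (b * y : group_ring F G)).
  by rewrite -!mcoeff_neq0 axEc oppr_eq0.
have b0 : b != 0.
  apply: contraTneq (gr_mul_neq0 p0 deck displacement a0 x0) => b0.
  by rewrite axE b0 mul0r oppr0 eqxx.
have [be0 [et0 [be0b et0y bd_by]]] := farthest_product act p0 p0 b0 y0.
set D := hdist _ _ in bd_by.
have deep0 : D - 100 <= hdist p0 (pt (be0 * et0)%g) by rewrite -/D; lra.
have supp_ax h k : h \in msupp b -> k \in msupp y ->
    D - 100 <= hdist p0 (pt (h * k)%g) -> exists h' k',
    [/\ h' \in msupp a, k' \in msupp x & (h * k = h' * k')%g].
  move=> hb ky deep; apply: msupp_gr_mul; rewrite supp_eq.
  exact: (msupp_outer deck displacement y0 bd_by).
(* The farthest product of [a] and [x] survives in [a * x], hence occurs in [b * y], where [D] is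
   the maximum. *)
have bd_ax : bounded_product act p0 p0 a x D.
  have [h [k [ha kx bd]]] := farthest_product act p0 p0 a0 x0.
  have : (h * k)%g \in msupp (a * x : group_ring F G).
    by apply: (msupp_outer deck displacement x0 bd) => //; lra.
  rewrite supp_eq => /msupp_gr_mul[h' [k' [hb' ky' E]]] h1 k1 ha1 kx1.
  by apply: le_trans (bd _ _ ha1 kx1) _; rewrite E; apply: bd_by.
have [al [ga0 [ala ga0x E0]]] := supp_ax _ _ be0b et0y deep0.
have [c cx] := center_exists act p0 x0.
have c_le := center_bound deck cx bd_ax ala.
have c_ge : D <= hdist p0 (act al c) + N x / 2 + 13.
  have := hdist_weak_triangle p0 (pt (al * ga0)%g) (act al c).
  by rewrite (hdist_translate _ deck) -E0 -/D; have := cx.1 _ ga0x; lra.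
(* The translates of y that reach the outer part of al x; by same_translate,
   the outer part of each of them then lies entirely in al x. *)
pose inB be := has (fun et => (D - 100 <= hdist p0 (pt (be * et)%g)) &&
                     ((al^-1 * (be * et))%g \in msupp x)) (msupp y).
have inB_supp be et : be \in msupp b -> inB be -> et \in msupp y ->
    D - 100 <= hdist p0 (pt (be * et)%g) -> (al^-1 * (be * et))%g \in msupp x.
  move=> beb /hasP[et1 et1y /andP[deep1 et1x]] ety deep.
  have [al' [ga' [ala' gax' E]]] := supp_ax _ _ beb ety deep.
  suff alE : al = al' by rewrite E -alE mulKg.
  apply: (same_translate deck displacement x0 bd_ax ala et1x ala' gax').
  - by rewrite mulVKg.
  - by rewrite -E.
  rewrite mulVKg -E !(deck_actM deck) (deck_isometry deck).
  by have := hdist_le_diam act p0 et1y ety; lra.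
have translate_near be et : be \in msupp b -> inB be -> et \in msupp y ->
    hdist (act al c) (pt (be * et)%g) <= N x / 2 + 13.
  move=> beb Bbe ety.
  have /hasP[et1 et1y /andP[deep1 et1x]] := Bbe.
  (* Choosing the farthest point of [be y] settles one four-point alternative with error 7 + 6 = 13.
     The other yields [N y - N x / 2 + 113], which suffices only when [N y + 100 <= N x]. *)
  have [et2 et2y max_et2] := exists_argmax (fun k => hdist p0 (pt (be * k)%g)) et1y.
  have deep2 : D - 100 <= hdist p0 (pt (be * et2)%g).
    by apply: le_trans deep1 _; apply: max_et2.
  have et2x := inB_supp _ _ beb Bbe et2y deep2.
  have := cx.1 _ et2x; rewrite -(hdist_translate p0 deck al) mulVKg => near2.
  have := hdist_four_point (act al c) (pt (be * et)%g) p0 (pt (be * et2)%g).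
  rewrite (hdistC (act al c) p0) (hdistC (pt (be * et)%g) p0).
  have := max_et2 _ ety.
  have -> : hdist (pt (be * et)%g) (pt (be * et2)%g) = hdist (pt et) (pt et2).
    by rewrite !(deck_actM deck) (deck_isometry deck).
  have le_y := hdist_le_diam act p0 ety et2y.
  (* If y is almost as large as x, then only be0 y reaches the outer part of al x. *)
  have [small|large] := leP (N y + 100) (N x); first by move=> ? []; lra.
  have E : be = be0.
    apply: (same_translate deck displacement y0 bd_by beb et1y be0b et0y) => //.
    rewrite -[(be * et1)%g](mulVKg al) E0 (deck_actM deck al) (deck_actM deck al).
    rewrite (deck_isometry deck); have := hdist_le_diam act p0 et1x ga0x; lra.
  have := max_et2 _ et0y; rewrite {1}E -/D => ge_D ? [] ; lra.
(* On the outer part of [al x] the relation reads a_al x_(al^-1 g) + (b y)_g = 0; dividing by a_al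
   dictates these coefficients. *)
pose q : group_ring F G := - \sum_(be <- msupp b | inB be)
  (mkmalgU (al^-1 * be)%g ((a@_al)^-1 * b@_be) : group_ring F G).
exists q; set x' := x - q * y.
have x'E g : x'@_(al^-1 * g)%g = x@_(al^-1 * g)%g +
    (a@_al)^-1 * \sum_(be <- msupp b | inB be) b@_be * y@_(be^-1 * g)%g.
  rewrite /x' /q mulNr opprK mcoeffD mulr_suml raddf_sum /= mulr_sumr.
  congr (_ + _); apply: eq_bigr => be _.
  by rewrite mcoeff_gr_mulU mulrA invgM invgK -mulgA mulVKg.
have supp_x' g : (al^-1 * g)%g \in msupp x' ->
   hdist p0 (pt g) <= D - 100 /\ hdist (act al c) (pt g) <= N x / 2 + 13.
  move=> gx'; split; last first.
    have [gx|gNx] := boolP ((al^-1 * g)%g \in msupp x).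
      by have := cx.1 _ gx; rewrite -(hdist_translate p0 deck al) mulVKg; lra.
    have [/hasP[be beb /andP[Bbe]]|none] := boolP (has (fun be => inB be &&
        ((be^-1 * g)%g \in msupp y)) (msupp b)).
      by move=> /(translate_near _ _ beb Bbe); rewrite mulVKg.
    move: gx'; rewrite -mcoeff_neq0 x'E (mcoeff_outdom gNx) big1_seq.
      by rewrite mulr0 addr0 eqxx.
    move=> be /andP[Bbe beb]; move/hasPn: none => /(_ be beb).
    by rewrite Bbe /= => /mcoeff_outdom ->; rewrite mulr0.
  have [//|/ltW deep] := leP (hdist p0 (pt g)) (D - 100).
  move: gx'; rewrite -mcoeff_neq0 x'E; case/eqP.
  have [gx|gNx] := boolP ((al^-1 * g)%g \in msupp x); last first.
    rewrite (mcoeff_outdom gNx) big1_seq ?mulr0 ?addr0 // => be /andP[Bbe beb].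
    case: (boolP ((be^-1 * g)%g \in msupp y)) => [gy|/mcoeff_outdom->].
      have := inB_supp _ _ beb Bbe gy; rewrite mulVKg => /(_ deep) gx.
      by rewrite gx in gNx.
    by rewrite mulr0.
  have axg : (a * x : group_ring F G)@_g = a@_al * x@_(al^-1 * g)%g.
    rewrite -{1}(mulVKg al g).
    by apply: (mcoeff_outer deck displacement x0 bd_ax); rewrite ?mulVKg.
  (* A translate outside [inB] cannot contain [g], which is deep and lies in [al x]. *)
  have -> : \sum_(be <- msupp b | inB be) b@_be * y@_(be^-1 * g)%g =
      (b * y : group_ring F G)@_g.
    rewrite mcoeff_gr_mul [RHS](bigID inB) /= [X in _ = _ + X]big1_seq ?addr0 //.
    move=> be /andP[NBbe beb].
    case: (boolP ((be^-1 * g)%g \in msupp y)) => [gy|/mcoeff_outdom->].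
      by case/hasP: NBbe; exists (be^-1 * g)%g; rewrite ?mulVKg // deep.
    by rewrite mulr0.
  rewrite -[(b * y)@_g]opprK -axEc axg mulrN mulKf ?subrr //.
  by rewrite mcoeff_neq0.
have [->|x'0] := eqVneq x' 0; [by left|right].
have [g [h [gx' hx' ->]]] := diam_attained act p0 x'0.
move: gx' hx'; rewrite -(mulKg al g) -(mulKg al h).
move=> /supp_x'[g1 g2] /supp_x'[h1 h2].
(* Together with [c_ge] this bounds the distance by [N x] + 13 + 13 + 6 - 100. *)
have := hdist_four_point (pt (al * g)%g) (pt (al * h)%g) p0 (act al c).
rewrite !mulKg (hdistC (pt (al * g)%g) p0) (hdistC (pt (al * h)%g) p0).
rewrite (hdistC (pt (al * g)%g) (act al c)) (hdistC (pt (al * h)%g) (act al c)).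
have -> : hdist (pt (al * g)%g) (pt (al * h)%g) = hdist (pt g) (pt h).
  by rewrite !(deck_actM deck) (deck_isometry deck).
by case; lra.
Qed.
End Division.

(** * Separated sequences in the plane, by pigeonhole *)

Lemma truncn_eq_dist (R : realType) (s t : R) : 0 <= s -> 0 <= t ->
  Num.truncn s = Num.truncn t -> `|s - t| < 1.
Proof.
move=> s0 t0 st; have := truncn_itv s0; have := truncn_itv t0.
by rewrite st -natr1 ltr_norml; lra.
Qed.

(* Boxing the Euclidean coordinates: in a hyperbolic ball the height is bounded
   below, so points in a small enough box are hyperbolically close. *)
Lemma separated_sequence_unbounded (R : realType) (z : nat -> hplane R) p (B : R) :
  (forall i j, i != j -> 3 < hdist (z i) (z j)) ->
  exists i, B < hdist p (z i).
Proof.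
move=> sep; apply: contrapT => /forallNP bounded.
have {}bounded i : hdist p (z i) <= B by rewrite leNgt; apply/negP.
case pE : (hp_val p) => [u0 v0]; have v0_gt0 : 0 < v0 by have := hp_valP p; rewrite pE.
(* [T] bounds [chord p (z i)]. Clearing denominators, v^2 and v0^2 are each at most 2 v0 v T, whence
   the height bounds [M] and [m]. *)
pose T := expR B + 1; have T1 : 1 < T by rewrite ltrDr expR_gt0.
pose M := 2 * v0 * T; pose m := v0 / (2 * T).
have m0 : 0 < m by rewrite divr_gt0 // mulr_gt0 //; lra.
have M0 : 0 < M by rewrite !mulr_gt0 //; lra.
have box i : let: (u, v) := hp_val (z i) in
    [/\ m <= v, v <= M & `|u - u0| <= M].
  case zE : (hp_val (z i)) => [u v].
  have v_gt0 : 0 < v by have := hp_valP (z i); rewrite zE.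
  have : chord p (z i) <= T.
    rewrite chordE; have /andP[le_ _] := hdist_bounds p (z i).
    by rewrite lerD2r (le_trans le_) // ler_expR.
  rewrite /chord pE zE /= ler_pdivrMr ?mulr_gt0 // => le_T.
  have su := sqr_ge0 (u0 - u).
  have le_M : v <= M.
    rewrite -(ler_pM2l v_gt0) /M; have := sqr_ge0 v0.
    have : 0 < v0 * v by rewrite mulr_gt0.
    by move: le_T; nra.
  split=> //.
    rewrite /m ler_pdivrMr; last lra.
    rewrite -(ler_pM2l v0_gt0).
    have : 0 < v0 * v by rewrite mulr_gt0.
    by have := sqr_ge0 v; move: le_T; nra.
  rewrite -(@ler_pXn2r _ 2) ?nnegrE // ?(ltW M0) // real_normK ?num_real //.
  have : v0 * T * 2 * v <= M * M.
    by rewrite (_ : v0 * T * 2 = M) ?ler_pM2l // /M; ring.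
  have : 0 < v0 * v by rewrite mulr_gt0.
  by have := sqr_ge0 v; have := sqr_ge0 v0; move: le_T; nra.
pose K := (Num.truncn (2 * M / m)).+1.
pose cell i : 'I_K * 'I_K := let: (u, v) := hp_val (z i) in
  (inord (Num.truncn ((u - u0 + M) / m)), inord (Num.truncn (v / m))).
pose cells (i : 'I_(K * K).+1) := cell i.
have : ~~ injectiveb cells.
  apply/negP => /injectiveP/leq_card.
  by rewrite card_prod !card_ord ltnn.
case/injectivePn => i [j neq_ij]; rewrite /cells /cell.
have := sep i j neq_ij; have := box i; have := box j.
have := hdist_bounds (z i) (z j); rewrite /cosh_hdist.
case: (hp_val (z i)) (hp_val (z j)) => [u v] [u' v'] /= bd [mv' v'M u'M] [mv vM uM].
move=> sep_ij [/(congr1 val) + /(congr1 val)].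
move: uM u'M; rewrite !ler_norml => /andP[uM1 uM2] /andP[u'M1 u'M2].
have inK t : t <= 2 * M -> (Num.truncn (t / m) < K)%N.
  by move=> le_t; rewrite ltnS le_truncn // ler_pM2r ?invr_gt0.
have [lu lv] : u - u0 + M <= 2 * M /\ v <= 2 * M by split; lra.
have [lu' lv'] : u' - u0 + M <= 2 * M /\ v' <= 2 * M by split; lra.
rewrite /= !inordK ?inK //.
have close s t : 0 <= s -> 0 <= t -> Num.truncn (s / m) = Num.truncn (t / m) ->
    (s - t) ^+ 2 <= m ^+ 2.
  move=> s0 t0 /(truncn_eq_dist (divr_ge0 s0 (ltW m0)) (divr_ge0 t0 (ltW m0))).
  rewrite -mulrBl normrM (@gtr0_norm _ m^-1) ?invr_gt0 // ltr_pdivrMr // mul1r => lt_.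
  rewrite -(real_normK (num_real (s - t))).
  by rewrite lerXn2r ?nnegrE ?(ltW m0) // ltW.
move=> /close; rewrite (_ : u - u0 + M - (u' - u0 + M) = u - u'); last by ring.
move=> cu /close cv.
have {}cu : (u - u') ^+ 2 <= m ^+ 2 by apply: cu; lra.
have {}cv : (v - v') ^+ 2 <= m ^+ 2 by apply: cv; lra.
(* Then [cosh_hdist] is at most 2, so 1 + d <= e^d <= 4, against the separation d > 3. *)
have frac : ((u - u') ^+ 2 + (v - v') ^+ 2) / (2 * v * v') <= 1.
  have mm : m ^+ 2 <= v * v' by rewrite expr2 ler_pM // ltW.
  rewrite ler_pdivrMr ?mulr_gt0 //; lra.
have := expR_ge1Dx (hdist (z i) (z j)); move: bd sep_ij frac; lra.
Qed.

(** * Formal properties of the Euclidean process *)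

Section EuclideanRun.
Variables (R : realType) (A : nzRingType) (N : A -> R).
Implicit Types (x y z : A) (r q : nat -> A).

Definition related x y : Prop :=
  exists a b : A, (a != 0 \/ b != 0) /\ a * x + b * y = 0.

(** Substituting the division into a r_k + b r_(k+1) = 0 gives (a q_k + b) r_(k+1) + a r_(k+2) = 0.
    It stays nontrivial: if a = 0, the first coefficient is b. *)
Lemma related_euclid_run x y r q k :
  related x y -> euclid_run N x y r q k -> related (r k) (r k.+1).
Proof.
move=> rel [r0 r1 step]; elim: k step => [|k IH] step; first by rewrite r0 r1.
have [a [b [nz abr]]] : related (r k) (r k.+1).
  by apply: IH => i ik; apply: step; rewrite ltnS ltnW.
have [_ [rE _]] := step k (leqnn _).
exists (a * q k + b), a; split; last first.
  by rewrite -abr [in RHS]rE mulrDr mulrDl mulrA addrAC.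
have [a0|] := eqVneq a 0; last by right.
by left; case: nz; rewrite a0 ?eqxx // mul0r add0r.
Qed.

Lemma dividesD z x y : divides z x -> divides z y -> divides z (x + y).
Proof. by move=> [c ->] [d ->]; exists (c + d); rewrite mulrDl. Qed.

Lemma dividesB z x y : divides z x -> divides z y -> divides z (x - y).
Proof. by move=> [c ->] [d ->]; exists (c - d); rewrite mulrBl. Qed.

Lemma divides_mull z x c : divides z x -> divides z (c * x).
Proof. by move=> [d ->]; exists (c * d); rewrite mulrA. Qed.

Lemma euclid_run_gcd x y r q k :
  euclid_run N x y r q k.+1 -> r k.+2 = 0 ->
  [/\ r k.+1 != 0, divides (r k.+1) (r k) & is_gcd (r k.+1) x y].
Proof.
move=> [r0 r1 step] rk0; set z := r k.+1.
(* Divisibility by [z] climbs back from the end of the run; below, that by a common divisor [z']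
   descends from its start. *)
have z_div i : (i <= k.+1)%N -> divides z (r (k.+1 - i)%N) /\ divides z (r (k.+1 - i).+1%N).
  elim: i => [_|i IH ik].
    by rewrite subn0 rk0; split; [exists 1; rewrite mul1r|exists 0; rewrite mul0r].
  have [d1 d2] := IH (ltnW ik).
  have [_ [rE _]] := step (k - i)%N (leq_subr i k).
  move: d1 d2; rewrite subSS (@subSn i k ik) => d1 d2; split=> //.
  by rewrite rE; apply: dividesD => //; apply: divides_mull.
split; first by have [] := step k (leqnn _).
  by have := (z_div 1%N isT).1; rewrite subn1.
have := z_div k.+1 (leqnn _); rewrite subnn r0 r1 => -[zx zy].
split=> // z' z'x z'y.
have z'_div i : (i <= k.+1)%N -> divides z' (r i) /\ divides z' (r i.+1).
  elim: i => [_|i IH ik]; first by rewrite r0 r1.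
  have [d1 d2] := IH (ltnW ik); split=> //.
  have [_ [rE _]] := step _ ik.
  have -> : r i.+2 = r i - q i * r i.+1 by rewrite [in RHS]rE addrC addKr.
  by apply: dividesB => //; apply: divides_mull.
by have [] := z'_div k.+1 (leqnn _).
Qed.

Lemma euclid_run_terminates x y :
  related x y -> y != 0 ->
  (forall u v, related u v -> v != 0 -> exists w w', division_step N u v w w') ->
  (forall r q, ~ (forall k, euclid_run N x y r q k)) ->
  exists r q k, euclid_run N x y r q k.+1 /\ r k.+2 = 0.
Proof.
move=> rel y0 divide no_infinite.
(* Choice turns the existence of divisions into a function on all pairs, with a dummy value where no
   division is guaranteed. *)
have [F FP] : {F : A * A -> A * A & forall u, related u.1 u.2 -> u.2 != 0 ->
    division_step N u.1 u.2 (F u).1 (F u).2}.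
  apply: (@choice _ _ (fun u w => related u.1 u.2 -> u.2 != 0 ->
    division_step N u.1 u.2 w.1 w.2)) => -[u v] /=.
  have [uv|nuv] := pselect (related u v /\ v != 0); last first.
    by exists 0 => ? ?; case: nuv.
  by have [q [r step]] := divide u v uv.1 uv.2; exists (q, r).
pose s n := iter n (fun u => (u.2, (F u).2)) (x, y).
pose r n := (s n).1; pose q n := (F (s n)).1.
have run m : (forall i, (i < m)%N -> r i.+1 != 0) -> euclid_run N x y r q m.
  elim: m => [|m IH] nz; first by split.
  have run_m := IH (fun i im => nz i (ltnW im)).
  have rel_m := related_euclid_run rel run_m.
  case: run_m => r0 r1 step; split=> // i; rewrite ltnS leq_eqVlt => /predU1P[->|/step//].
  by split; [apply: nz|apply: FP => //; apply: nz].
have [n rn0] : exists n, r n.+1 == 0.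
  apply: contrapT => /forallNP nz; apply: (no_infinite r q) => k.
  by apply: run => i _; apply/negP/nz.
have [|n' /eqP n'0 n'_min] := ex_minnP (P := fun n => r n.+1 == 0); first by exists n.
case: n' n'0 n'_min => [|k] rk0 k_min; first by rewrite /r /= in rk0; rewrite rk0 eqxx in y0.
exists r, q, k; split=> //; apply: run => i ik.
by apply: contraTneq ik => ri0; rewrite -leqNgt k_min ?ri0.
Qed.

End EuclideanRun.

(** * Existence of divisions and finiteness of descent *)

Section DivisionAlgorithm.
Variables (R : realType) (G : groupType) (act : G -> hplane R -> hplane R).
Variables (F : fieldType) (p0 : hplane R).
Hypothesis deck : deck_action act.
Hypothesis displacement :
  forall (g : G) p, g != 1%g -> 2000%:R <= hdist p (act g p).
Implicit Types (a b x y : group_ring F G).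
Local Notation N := (@diam R G act F p0).
Local Notation pt g := (act g p0).

(** The induction is on an integer above [N x]. The relation a (x - q y) + (b + a q) y = 0 keeps the
    same [a], which is nonzero because there are no zero divisors. *)
Lemma division_exists x y : related x y -> y != 0 ->
  exists q r, division_step N x y q r.
Proof.
move=> [a [b [nz rel]]] y0.
have a0 : a != 0.
  have [a0|//] := eqVneq a 0; case: nz => [|b0]; first by rewrite a0 eqxx.
  case/eqP: (gr_mul_neq0 p0 deck displacement b0 y0).
  by move: rel; rewrite a0 mul0r add0r.
have [n] : exists n : nat, N x < n%:R by exists (Num.truncn (N x)).+1; apply: truncnS_gt.
elim: n x b rel {nz} => [|n IH] x b rel lt_n.
  by have := diam_ge0 act p0 x; lra.
have [->|x0] := eqVneq x 0.
  by exists 0, 0; rewrite /division_step mul0r addr0; split; [|right].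
have [le_yx|lt_xy] := leP (N y) (N x); last first.
  by exists 0, x; rewrite /division_step mul0r add0r; split; [|left].
have [q [q0|le_q]] := diam_reduction deck displacement a0 x0 y0 rel le_yx.
  by exists q, 0; split; [rewrite addr0; apply/eqP; rewrite -subr_eq0 q0|right].
have [||q' [r [xE le_r]]] := IH (x - q * y) (b + a * q).
- by rewrite mulrBr mulrDl mulrA addrA addrAC subrK.
- by move: lt_n; rewrite -natr1; lra.
exists (q + q'), r; split=> //.
by rewrite mulrDl -addrA -xE addrC subrK.
Qed.

Lemma diam_descent_finite (r : nat -> group_ring F G) :
  (forall i, r i != 0) -> ~ (forall i, N (r i.+1) < N (r i)).
Proof.
move=> r0 desc.
have desc_lt i j : (i < j)%N -> N (r j) < N (r i).
  elim: j => // j IH; rewrite ltnS leq_eqVlt => /predU1P[->//|/IH].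
  exact: lt_trans.
have [f fE] : {f : nat -> G & forall i, N (r i) = hdist p0 (pt (f i))}.
  apply: (@choice _ _ (fun i g => N (r i) = hdist p0 (pt g))) => i.
  have [g [h [_ _ ->]]] := diam_attained act p0 (r0 i).
  (* Translating by g^-1 moves one end of the diametral pair to [p0], so distinct diameters give
     distinct orbit points, all within [N (r 0)] of [p0]. *)
  exists (g^-1 * h)%g.
  by rewrite -[RHS](hdist_translate p0 deck g) mulVKg.
have [i j neq_ij|i] :=
    separated_sequence_unbounded (z := fun i => pt (f i)) p0 (N (r 0%N)).
  rewrite ltNge; apply/negP => le3.
  have fij : f i = f j by apply: (hdist_act_eq deck displacement (c := p0)); lra.
  have NE : N (r i) = N (r j) by rewrite !fE fij.
  by case: ltngtP neq_ij => // /desc_lt; rewrite NE ltxx.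
by rewrite -fE; case: i => [|i]; rewrite ?ltxx // ltNge ltW // desc_lt.
Qed.

End DivisionAlgorithm.

Theorem corollary2 (R : realType) (n : nat) (G : groupType)
    (act : G -> hplane R -> hplane R) (p0 : hplane R)
    (genus_large : expR (10 ^+ 6) <= n%:R :> R)
    (G_surface : surface_group n G)
    (G_deck : deck_action act)
    (G_displacement : 2000%:R <= inf_displacement act)
    (x y : group_ring rat G) (y_neq0 : y != 0)
    (relation : exists a b : group_ring rat G,
       (a != 0 \/ b != 0) /\ a * x + b * y = 0) :
  let N : group_ring rat G -> R := diam act p0 in
  [/\ (* a division is possible at every stage *)
      forall r q k, euclid_run N x y r q k -> r k.+1 != 0 ->
        exists q' r', division_step N (r k) (r k.+1) q' r',
      (* the process cannot go on forever *)
      forall r q, ~ (forall k, euclid_run N x y r q k),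
      (* it can be carried out to the end *)
      exists r q k, euclid_run N x y r q k.+1 /\ r k.+2 = 0 &
      (* and however it is carried out, the last nonzero remainder is a gcd *)
      forall r q k, euclid_run N x y r q k.+1 -> r k.+2 = 0 ->
        [/\ r k.+1 != 0, divides (r k.+1) (r k) & is_gcd (r k.+1) x y]].
Proof.
have displacement (g : G) p : g != 1%g -> 2000%:R <= hdist p (act g p).
  move=> g1; apply: le_trans G_displacement _; apply: ge_inf; last by exists p, g.
  by exists 0 => _ [p' [g' [_ ->]]]; apply: hdist_ge0.
move=> N.
have no_infinite r q : ~ (forall k, euclid_run N x y r q k).
  (* The descent starts at r 1 = y, since x may be zero or of smaller diameter than y. *)
  move=> run; apply: (diam_descent_finite (p0 := p0) G_deck displacement (r := fun i => r i.+1)).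
    by move=> i; have [_ _ /(_ i (leqnn _))[]] := run i.+1.
  move=> i; have [_ _ step] := run i.+2.
  have [_ [_ []//]] := step i (leqnSn _).
  by have [/eqP] := step i.+1 (leqnn _).
have divide := @division_exists _ _ _ rat p0 G_deck displacement.
split.
- move=> r q k run; apply: divide.
  exact: related_euclid_run relation run.
- exact: no_infinite.
- exact: euclid_run_terminates relation y_neq0 divide no_infinite.
- by move=> r q k; apply: euclid_run_gcd.
Qed.
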